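(* There exists a continuum of fixed points of the period tripling renormalization operator $R$ acting on $C^{1+Lip}$ unimodal maps.
   Context: A unimodal map is a $C^1$ map $f:[0,1]\to[0,1]$ with a unique critical point $c$, normalized here by $f(c)=1$, $f(1)=0$. It is $C^{1+Lip}$ if its derivative is Lipschitz. $f$ is period tripling renormalizable if $f(0)<c<f^4(0)$ and, with $J=[f(0),f^4(0)]$ a proper subinterval, the intervals $f^2(J),J,f(J)$ have pairwise disjoint interiors, lie in this order from left to right, and $f^3(J)\subset J$. Then $Rf=h^{-1}\circ f^3\circ h$ with $h:[0,1]\to J$ the orientation reversing affine homeomorphism. A fixed point of $R$ is a period tripling renormalizable map $f$ with $Rf=f$. ''A continuum of fixed points'' means a family of pairwise distinct fixed points having the cardinality of the continuum. *)

(* Defs.v *)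
(* Maps of [0,1] are functions R -> R of which only the
   restriction to [0,1] matters; two of them are the same map when they agree
   on [0,1]. *)
From Stdlib Require Import Reals.
Open Scope R_scope.

Definition unit_interval (x : R) : Prop := 0 <= x <= 1.

(* [D_in] is the derivative relative to [0,1], hence one-sided at 0 and 1. *)
Definition is_derivative (f df : R -> R) : Prop :=
  forall x, unit_interval x -> D_in f df unit_interval x.

Definition continuous_on_unit (g : R -> R) : Prop :=
  forall x, unit_interval x -> continue_in g unit_interval x.

Definition lipschitz_on_unit (g : R -> R) : Prop :=
  exists K : R, forall x y, unit_interval x -> unit_interval y ->
    Rabs (g x - g y) <= K * Rabs (x - y).

Definition critical_point (df : R -> R) (c : R) : Prop :=
  unit_interval c /\ df c = 0.

Definition unimodal_with (f df : R -> R) (c : R) : Prop :=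
  (forall x, unit_interval x -> unit_interval (f x)) /\
  is_derivative f df /\
  continuous_on_unit df /\
  unique (critical_point df) c /\
  f c = 1 /\
  f 1 = 0.

Definition C1Lip_unimodal (f : R -> R) (c : R) : Prop :=
  exists df : R -> R, unimodal_with f df c /\ lipschitz_on_unit df.

Definition J (f : R -> R) (y : R) : Prop := f 0 <= y <= Nat.iter 4 f 0.

Definition proper_subset (A B : R -> Prop) : Prop :=
  included A B /\ ~ included B A.

Definition disjoint_interiors (A B : R -> Prop) : Prop :=
  forall x, ~ (interior A x /\ interior B x).

Definition left_of (A B : R -> Prop) : Prop :=
  forall a b, A a -> B b -> a <= b.

Definition tripling_renormalizable (f : R -> R) (c : R) : Prop :=
  let J0 := J f in
  let J1 := image_dir f J0 in
  let J2 := image_dir (Nat.iter 2 f) J0 in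
  let J3 := image_dir (Nat.iter 3 f) J0 in
  f 0 < c < Nat.iter 4 f 0 /\
  proper_subset J0 unit_interval /\
  disjoint_interiors J2 J0 /\
  disjoint_interiors J0 J1 /\
  disjoint_interiors J2 J1 /\
  left_of J2 J0 /\
  left_of J0 J1 /\
  included J3 J0.

(* The affine bijection [0,1] -> J with 0 |-> f^4(0) and 1 |-> f(0). *)
Definition h (f : R -> R) (x : R) : R :=
  Nat.iter 4 f 0 - (Nat.iter 4 f 0 - f 0) * x.

Definition h_inv (f : R -> R) (y : R) : R :=
  (Nat.iter 4 f 0 - y) / (Nat.iter 4 f 0 - f 0).

Lemma h_invK (f : R -> R) (x : R) :
  f 0 < Nat.iter 4 f 0 -> h_inv f (h f x) = x.
Proof.
intros H; unfold h_inv, h; field.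
now intros E; apply Rminus_diag_uniq in E; rewrite E in H; apply Rlt_irrefl in H.
Qed.

Lemma hK (f : R -> R) (y : R) :
  f 0 < Nat.iter 4 f 0 -> h f (h_inv f y) = y.
Proof.
intros H; unfold h_inv, h; field.
now intros E; apply Rminus_diag_uniq in E; rewrite E in H; apply Rlt_irrefl in H.
Qed.

Definition renormalization (f : R -> R) (x : R) : R :=
  h_inv f (Nat.iter 3 f (h f x)).

Definition same_map (f g : R -> R) : Prop :=
  forall x, unit_interval x -> f x = g x.

Definition C1Lip_fixed_point (f : R -> R) : Prop :=
  exists c : R,
    C1Lip_unimodal f c /\
    tripling_renormalizable f c /\
    same_map (renormalization f) f.

(* A family of pairwise distinct maps indexed by the set R, hence of the
   cardinality of the continuum. *)
Definition continuum_of (P : (R -> R) -> Prop) : Prop :=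
  exists F : R -> (R -> R),
    (forall t, P (F t)) /\
    (forall s t, s <> t -> ~ same_map (F s) (F t)).

(* Main.v *)
Require Import Defs.
From Stdlib Require Import Reals Lra Lia ClassicalEpsilon.
Open Scope R_scope.

(** Let l be the length of J.  If f is affine on f(J) and on f^2(J), with
    product of slopes -1/l, the equation Rf = f says only that 1 - f on J is
    1 - f on [0,1] shrunk by the factor l horizontally, with a flip, and by l^2
    vertically.  So f is determined by its values off
    J, which may be chosen freely up to a few conditions: affine on the two
    intervals f(J) and f^2(J), and first-order matching at the ends of J (the
    structure [seed]).  The values on J then follow by infinitely many
    rescalings towards the critical point c, the fixed point of h.

    The smoothness class survives because the scalings l and l^2 preserve
    second-order quantities: derivatives are multiplied by -l, lengths by l, so
    the Lipschitz constant of the derivative is the same on every scale.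
    [C11] expresses this in a form that can be rescaled ([C11_affine]), glued
    at a common end ([C11_glue]) and passed to pointwise limits, as it
    constrains only two points at a time.

    The infinite rescaling is the limit of [refine], applied repeatedly to the
    seed ([refinement_limit]).  At x <> c the iterates become constant once
    l^n is below the distance from x to c ([approx_stable]), and at c all of
    them are 1, so every property of the iterates that involves finitely many
    points holds for the limit.  [self_similar_fixed_point] then follows
    J -> f(J) -> f^2(J) -> J, the last two maps being affine with product
    of slopes -1/l.

    Between f^2(J) and J a seed may be any C^{1+Lip} map with values in [0,1]
    and nonvanishing derivative that has the right end values and end slopes.
    A quartic arc in Bernstein form has one free middle control value under
    these constraints, and varying it in an interval gives the continuum: the
    fixed point agrees with the seed off J, so different control values give
    different fixed points. *)

(** * A scale-invariant form of Lipschitz differentiability *)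

(** First-order Taylor estimate together with the Lipschitz bound, with one
    constant.  Differentiability is built into the first inequality, so that
    the pair is closed under pointwise limits without any uniformity. *)
Definition C11 (K : R) (f d : R -> R) (p q : R) : Prop :=
  forall x y, p <= x <= q -> p <= y <= q ->
    Rabs (f y - f x - d x * (y - x)) <= K * (y - x) ^ 2 /\
    Rabs (d y - d x) <= K * Rabs (y - x).

Lemma C11_weaken K K' f d p q : K <= K' -> C11 K f d p q -> C11 K' f d p q.
Proof.
intros HK H x y Hx Hy; destruct (H x y Hx Hy) as [H1 H2]; split.
- apply Rle_trans with (1 := H1), Rmult_le_compat_r; [apply pow2_ge_0 | exact HK].
- apply Rle_trans with (1 := H2), Rmult_le_compat_r; [apply Rabs_pos | exact HK].
Qed.

Lemma C11_ext K f d g e p q :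
  (forall x, p <= x <= q -> f x = g x) -> (forall x, p <= x <= q -> d x = e x) ->
  C11 K f d p q -> C11 K g e p q.
Proof.
intros Hf Hd H x y Hx Hy.
rewrite <- (Hf x Hx), <- (Hf y Hy), <- (Hd x Hx), <- (Hd y Hy); auto.
Qed.

(** When x and y lie on two sides of q, Taylor expansion through q leaves the
    cross term (d q - d x) * (y - q), at most K * |q - x| * |y - q|; the three
    bounds add up to at most K * (|q - x| + |y - q|)^2, hence no loss in K. *)
Lemma C11_concat K f d p q r :
  0 <= K -> p <= q <= r -> C11 K f d p q -> C11 K f d q r -> C11 K f d p r.
Proof.
intros HK Hpqr H1 H2 x y Hx Hy.
destruct (Rle_dec x q) as [xq | xq], (Rle_dec y q) as [yq | yq].
- apply H1; lra.
- destruct (H1 x q) as [A1 A2]; [lra | lra |].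
  destruct (H2 q y) as [B1 B2]; [lra | lra |].
  rewrite (Rabs_pos_eq (q - x)) in A2 by lra.
  rewrite (Rabs_pos_eq (y - q)) in B2 by lra.
  rewrite (Rabs_pos_eq (y - x)) by lra.
  split.
  + replace (f y - f x - d x * (y - x)) with
      ((f y - f q - d q * (y - q)) + (f q - f x - d x * (q - x))
       + (d q - d x) * (y - q)) by ring.
    assert (Rabs ((d q - d x) * (y - q)) <= K * (q - x) * (y - q)).
    { rewrite Rabs_mult, (Rabs_pos_eq (y - q)) by lra.
      apply Rmult_le_compat_r; lra. }
    assert (0 <= K * ((q - x) * (y - q))) by (apply Rmult_le_pos; [lra | apply Rmult_le_pos; lra]).
    eapply Rle_trans; [apply Rabs_triang |].
    eapply Rle_trans; [apply Rplus_le_compat_r, Rabs_triang |].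
    nra.
  + replace (d y - d x) with ((d y - d q) + (d q - d x)) by ring.
    eapply Rle_trans; [apply Rabs_triang | lra].
- destruct (H2 x q) as [A1 A2]; [lra | lra |].
  destruct (H1 q y) as [B1 B2]; [lra | lra |].
  rewrite (Rabs_left1 (q - x)) in A2 by lra.
  rewrite (Rabs_left1 (y - q)) in B2 by lra.
  rewrite (Rabs_left1 (y - x)) by lra.
  split.
  + replace (f y - f x - d x * (y - x)) with
      ((f y - f q - d q * (y - q)) + (f q - f x - d x * (q - x))
       + (d q - d x) * (y - q)) by ring.
    assert (Rabs ((d q - d x) * (y - q)) <= K * (x - q) * (q - y)).
    { rewrite Rabs_mult, (Rabs_left1 (y - q)) by lra.
      replace (- (y - q)) with (q - y) by ring.
      apply Rmult_le_compat_r; lra. }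
    assert (0 <= K * ((x - q) * (q - y))) by (apply Rmult_le_pos; [lra | apply Rmult_le_pos; lra]).
    eapply Rle_trans; [apply Rabs_triang |].
    eapply Rle_trans; [apply Rplus_le_compat_r, Rabs_triang |].
    nra.
  + replace (d y - d x) with ((d y - d q) + (d q - d x)) by ring.
    eapply Rle_trans; [apply Rabs_triang | lra].
- apply H2; lra.
Qed.

Definition glue (q : R) (f g : R -> R) (x : R) : R :=
  if Rle_dec x q then f x else g x.

Lemma glue_left q f g x : x <= q -> glue q f g x = f x.
Proof. intros H; unfold glue; destruct (Rle_dec x q); [reflexivity | lra]. Qed.

Lemma glue_right q f g x : q < x -> glue q f g x = g x.
Proof. intros H; unfold glue; destruct (Rle_dec x q); [lra | reflexivity]. Qed.

Lemma glue_right_eq q f g x : f q = g q -> q <= x -> glue q f g x = g x.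
Proof.
intros E H; unfold glue; destruct (Rle_dec x q); [| reflexivity].
now replace x with q by lra.
Qed.

Lemma C11_glue K f d g e p q r :
  0 <= K -> p <= q <= r -> f q = g q -> d q = e q ->
  C11 K f d p q -> C11 K g e q r -> C11 K (glue q f g) (glue q d e) p r.
Proof.
intros HK Hpqr Ef Ed H1 H2; apply C11_concat with q; auto.
- eapply C11_ext; [| | exact H1]; intros x Hx; rewrite glue_left; lra.
- eapply C11_ext; [| | exact H2]; intros x Hx; rewrite glue_right_eq; auto; lra.
Qed.

Lemma C11_glue_exists f d g e p q r :
  p <= q <= r -> f q = g q -> d q = e q ->
  (exists K, C11 K f d p q) -> (exists K, C11 K g e q r) ->
  exists K, C11 K (glue q f g) (glue q d e) p r.
Proof.
intros Hpqr Ef Ed [K1 H1] [K2 H2].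
exists (Rmax 0 (Rmax K1 K2)); apply C11_glue; auto.
- apply Rmax_l.
- revert H1; apply C11_weaken, Rle_trans with (2 := Rmax_r _ _), Rmax_l.
- revert H2; apply C11_weaken, Rle_trans with (2 := Rmax_r _ _), Rmax_r.
Qed.

(** Vertical factor B and horizontal factor s change K by |B| * s^2, which is 1
    for the scalings of renormalization. *)
Lemma C11_affine A B s t K f d p q p' q' :
  C11 K f d p q ->
  (forall x, p' <= x <= q' -> p <= s * x + t <= q) ->
  C11 (Rabs B * s ^ 2 * K) (fun x => A + B * f (s * x + t))
    (fun x => B * s * d (s * x + t)) p' q'.
Proof.
intros H Hst x y Hx Hy.
destruct (H _ _ (Hst x Hx) (Hst y Hy)) as [H1 H2].
replace (s * y + t - (s * x + t)) with (s * (y - x)) in H1, H2 by ring.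
split.
- match goal with |- Rabs ?u <= _ => replace u with
    (B * (f (s * y + t) - f (s * x + t) - d (s * x + t) * (s * (y - x)))) by ring end.
  rewrite Rabs_mult.
  replace (Rabs B * s ^ 2 * K * (y - x) ^ 2) with (Rabs B * (K * (s * (y - x)) ^ 2)) by ring.
  apply Rmult_le_compat_l; [apply Rabs_pos | exact H1].
- replace (B * s * d (s * y + t) - B * s * d (s * x + t)) with
    (B * s * (d (s * y + t) - d (s * x + t))) by ring.
  rewrite !Rabs_mult.
  rewrite Rabs_mult in H2.
  replace (Rabs B * s ^ 2 * K * Rabs (y - x)) with
    (Rabs B * Rabs s * (K * (Rabs s * Rabs (y - x)))).
  + apply Rmult_le_compat_l; [apply Rmult_le_pos; apply Rabs_pos | exact H2].
  + rewrite <- (pow2_abs s); ring.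
Qed.

Lemma C11_derivative K f d : C11 K f d 0 1 -> is_derivative f d.
Proof.
intros H x Hx eps Heps.
assert (0 < Rabs K + 1) by (pose proof (Rabs_pos K); lra).
exists (eps / (Rabs K + 1)); split; [apply Rdiv_lt_0_compat; lra |].
intros y [[Hy Hne] Hdist]; simpl in *; unfold Rdist in *.
assert (0 < Rabs (y - x)) by (apply Rabs_pos_lt; lra).
destruct (H x y Hx Hy) as [Hq _].
replace ((f y - f x) / (y - x) - d x) with ((f y - f x - d x * (y - x)) * / (y - x))
  by (field; lra).
rewrite Rabs_mult, Rabs_inv.
apply Rmult_lt_reg_r with (Rabs (y - x)); [assumption |].
rewrite Rmult_assoc, Rinv_l, Rmult_1_r by lra.
apply Rle_lt_trans with (1 := Hq).
rewrite <- pow2_abs.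
apply Rmult_lt_compat_r with (r := Rabs K + 1) in Hdist; [| assumption].
unfold Rdiv in Hdist; rewrite Rmult_assoc, Rinv_l, Rmult_1_r in Hdist by lra.
pose proof (Rle_abs K); nra.
Qed.

Lemma C11_lipschitz K f d : C11 K f d 0 1 -> lipschitz_on_unit d.
Proof.
intros H; exists K; intros x y Hx Hy; exact (proj2 (H y x Hy Hx)).
Qed.

Lemma lipschitz_continuous g : lipschitz_on_unit g -> continuous_on_unit g.
Proof.
intros [K HK] x Hx eps Heps.
assert (0 < Rabs K + 1) by (pose proof (Rabs_pos K); lra).
exists (eps / (Rabs K + 1)); split; [apply Rdiv_lt_0_compat; lra |].
intros y [[Hy _] Hdist]; simpl in *; unfold Rdist in *.
apply Rle_lt_trans with (1 := HK y x Hy Hx).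
apply Rmult_lt_compat_r with (r := Rabs K + 1) in Hdist; [| assumption].
unfold Rdiv in Hdist; rewrite Rmult_assoc, Rinv_l, Rmult_1_r in Hdist by lra.
pose proof (Rle_abs K); pose proof (Rabs_pos (y - x)); nra.
Qed.

(** * Pulling a map back to the renormalization interval *)

(** A copy of f on [a,b], flipped, shrunk horizontally by b - a and, measured
    from the maximal value 1, vertically by (b - a)^2; these factors are the
    ones that preserve the Lipschitz constant of the derivative [dpull]. *)
Definition pull (a b : R) (f : R -> R) (x : R) : R :=
  1 - (b - a) ^ 2 * (1 - f ((b - x) / (b - a))).

Definition dpull (a b : R) (d : R -> R) (x : R) : R :=
  - (b - a) * d ((b - x) / (b - a)).

Lemma rescale_unit a b x : a < b -> a <= x <= b -> 0 <= (b - x) / (b - a) <= 1.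
Proof.
intros Hab Hx; split.
- apply Rmult_le_pos; [lra | left; apply Rinv_0_lt_compat; lra].
- apply Rmult_le_reg_r with (b - a); [lra |].
  unfold Rdiv; rewrite Rmult_assoc, Rinv_l; lra.
Qed.

Lemma C11_pull K a b f d :
  a < b -> C11 K f d 0 1 -> C11 K (pull a b f) (dpull a b d) a b.
Proof.
intros Hab H.
apply C11_weaken with (Rabs ((b - a) ^ 2) * (- / (b - a)) ^ 2 * K).
{ rewrite Rabs_pos_eq by apply pow2_ge_0; right; field; lra. }
eapply C11_ext; [| | apply (C11_affine (1 - (b - a) ^ 2) ((b - a) ^ 2)
  (- / (b - a)) (b / (b - a)) _ _ _ _ _ a b H)].
- intros x _; unfold pull.
  replace (- / (b - a) * x + b / (b - a)) with ((b - x) / (b - a)) by (field; lra); ring.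
- intros x _; unfold dpull.
  replace (- / (b - a) * x + b / (b - a)) with ((b - x) / (b - a)) by (field; lra).
  field; lra.
- intros x Hx.
  replace (- / (b - a) * x + b / (b - a)) with ((b - x) / (b - a)) by (field; lra).
  now apply rescale_unit.
Qed.

(** The data of a fixed point off J = [a,b].  Its affine branches send
    [1 - (b-a)^2, 1] onto [0,e] and [0,e] onto J, and the conditions at a and b
    make the pulled-back copy of f0 fit f0 to first order there.  What f0 does
    inside J is only the starting point of the refinement, but asking f0 to be
    unimodal on all of [0,1] lets every invariant start from f0 itself.  The
    equation for c says that c is fixed by h. *)
Record seed (a b e c : R) (f0 d0 : R -> R) : Prop := Seed {
  seed_order : 0 < e < a /\ a < b < 1 - (b - a) ^ 2;
  seed_center : b - (b - a) * c = c;
  seed_J2 : forall x, 0 <= x <= e -> f0 x = a + (b - a) / e * x;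
  seed_J1 : forall x, 1 - (b - a) ^ 2 <= x <= 1 -> f0 x = e / (b - a) ^ 2 * (1 - x);
  seed_at_a : f0 a = pull a b f0 a /\ d0 a = dpull a b d0 a;
  seed_at_b : f0 b = pull a b f0 b /\ d0 b = dpull a b d0 b;
  seed_range : forall x, 0 <= x <= 1 -> 0 <= f0 x <= 1;
  seed_peak : f0 c = 1;
  seed_critical : forall x, 0 <= x <= 1 -> d0 x = 0 <-> x = c;
  seed_C11 : exists K, C11 K f0 d0 0 1 }.

(** The invariant of the refinement.  Each clause mentions at most two points,
    which is what makes it pass to the pointwise limit. *)
Record extends_seed (K a b c : R) (f0 d0 f d : R -> R) : Prop := ExtendsSeed {
  ext_outside : forall x, 0 <= x <= 1 -> x <= a \/ b <= x -> f x = f0 x /\ d x = d0 x;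
  ext_range : forall x, 0 <= x <= 1 -> 0 <= f x <= 1;
  ext_peak : f c = 1;
  ext_critical : forall x, 0 <= x <= 1 -> d x = 0 <-> x = c;
  ext_C11 : C11 K f d 0 1 }.

(** The map f0 off J, and the pulled-back copy of f on J. *)
Definition refine (a b : R) (f0 f : R -> R) : R -> R :=
  glue a f0 (glue b (pull a b f) f0).

Definition drefine (a b : R) (d0 d : R -> R) : R -> R :=
  glue a d0 (glue b (dpull a b d) d0).

Lemma center_bounds a b c : a < b -> 0 < b < 1 -> b - (b - a) * c = c ->
  0 < c < 1 /\ a < c < b.
Proof.
intros Hab Hb Hc.
assert (0 < c) by (apply Rnot_le_lt; intros N; nra).
assert (c < 1) by (apply Rnot_le_lt; intros N; nra).
repeat split; nra.
Qed.

(** Rescaling from J to [0,1] expands distances to c by the factor 1/(b-a). *)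
Lemma rescale_center a b c x : a < b -> b - (b - a) * c = c ->
  (b - x) / (b - a) - c = - (x - c) / (b - a).
Proof.
intros Hab Hc; apply Rmult_eq_reg_r with (b - a); [| lra].
unfold Rdiv; rewrite Rmult_minus_distr_r, !Rmult_assoc, Rinv_l by lra; lra.
Qed.

Lemma refine_inside a b f0 f x : a < x <= b -> refine a b f0 f x = pull a b f x.
Proof. intros Hx; unfold refine; rewrite glue_right, glue_left; lra. Qed.

Lemma drefine_inside a b d0 d x : a < x <= b -> drefine a b d0 d x = dpull a b d x.
Proof. intros Hx; unfold drefine; rewrite glue_right, glue_left; lra. Qed.

Lemma pull_ends a b f : a < b ->
  pull a b f a = 1 - (b - a) ^ 2 * (1 - f 1) /\ pull a b f b = 1 - (b - a) ^ 2 * (1 - f 0).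
Proof.
intros H; unfold pull; split; f_equal; f_equal; f_equal; f_equal; field; lra.
Qed.

Lemma dpull_ends a b d : a < b ->
  dpull a b d a = - (b - a) * d 1 /\ dpull a b d b = - (b - a) * d 0.
Proof.
intros H; unfold dpull; split; f_equal; f_equal; field; lra.
Qed.

(** The values of [pull] at a and b depend on f only through f 1 and f 0, where
    f coincides with the seed. *)
Lemma extends_seed_at_ends K a b e c f0 d0 f d :
  seed a b e c f0 d0 -> extends_seed K a b c f0 d0 f d ->
  (f0 a = pull a b f a /\ d0 a = dpull a b d a) /\
  (f0 b = pull a b f b /\ d0 b = dpull a b d b).
Proof.
intros S E.
destruct (seed_order _ _ _ _ _ _ S) as [He Hab].
assert (0 <= (b - a) ^ 2) by apply pow2_ge_0.
destruct (ext_outside _ _ _ _ _ _ _ _ E 0) as [f00 d00]; [lra | lra |].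
destruct (ext_outside _ _ _ _ _ _ _ _ E 1) as [f01 d01]; [lra | lra |].
pose proof (seed_at_a _ _ _ _ _ _ S) as Ha.
pose proof (seed_at_b _ _ _ _ _ _ S) as Hb.
rewrite (proj1 (pull_ends a b _ (proj1 Hab))), (proj1 (dpull_ends a b _ (proj1 Hab))) in Ha.
rewrite (proj2 (pull_ends a b _ (proj1 Hab))), (proj2 (dpull_ends a b _ (proj1 Hab))) in Hb.
rewrite (proj1 (pull_ends a b f (proj1 Hab))), (proj1 (dpull_ends a b d (proj1 Hab))).
rewrite (proj2 (pull_ends a b f (proj1 Hab))), (proj2 (dpull_ends a b d (proj1 Hab))).
rewrite f00, f01, d00, d01; auto.
Qed.

Lemma extends_seed_refine K a b e c f0 d0 f d :
  0 <= K -> seed a b e c f0 d0 -> C11 K f0 d0 0 1 ->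
  extends_seed K a b c f0 d0 f d ->
  extends_seed K a b c f0 d0 (refine a b f0 f) (drefine a b d0 d).
Proof.
intros HK S H0 E.
destruct (seed_order _ _ _ _ _ _ S) as [He [Hab Hb1]].
assert (Hl2 : 0 < (b - a) ^ 2) by (apply pow_lt; lra).
pose proof (seed_center _ _ _ _ _ _ S) as Hc.
destruct (center_bounds a b c) as [c01 cab]; [lra | lra | exact Hc |].
destruct (extends_seed_at_ends _ _ _ _ _ _ _ _ _ S E) as [[Ea Da] [Eb Db]].
assert (Hin : forall x, 0 <= x <= 1 -> (x <= a \/ b <= x) \/ a < x < b) by (intros; lra).
assert (Hout : forall x, 0 <= x <= 1 -> x <= a \/ b <= x ->
  refine a b f0 f x = f0 x /\ drefine a b d0 d x = d0 x).
{ intros x Hx [Hxa | Hxb].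
  - unfold refine, drefine; rewrite !glue_left; auto.
  - unfold refine, drefine.
    rewrite (glue_right a f0), (glue_right a d0) by lra.
    rewrite !glue_right_eq; auto. }
split; auto.
- intros x Hx; destruct (Hin x Hx) as [Ho | Hi].
  + rewrite (proj1 (Hout x Hx Ho)); now apply (seed_range _ _ _ _ _ _ S).
  + rewrite refine_inside by lra; unfold pull.
    destruct (ext_range _ _ _ _ _ _ _ _ E ((b - x) / (b - a))) as [R1 R2];
      [apply rescale_unit; lra |].
    split; nra.
- rewrite refine_inside by lra; unfold pull.
  replace ((b - c) / (b - a)) with c.
  + rewrite (ext_peak _ _ _ _ _ _ _ _ E); ring.
  + apply Rmult_eq_reg_r with (b - a); [field_simplify; lra | lra].
- intros x Hx; destruct (Hin x Hx) as [Ho | Hi].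
  + rewrite (proj2 (Hout x Hx Ho)); now apply (seed_critical _ _ _ _ _ _ S).
  + rewrite drefine_inside by lra; unfold dpull.
    pose proof (ext_critical _ _ _ _ _ _ _ _ E ((b - x) / (b - a))
      (rescale_unit a b x Hab ltac:(lra))) as Hcr.
    pose proof (rescale_center a b c x Hab Hc) as Hre.
    split; intros Z.
    * apply Rmult_integral in Z; destruct Z as [Z | Z]; [lra |].
      apply Hcr in Z; rewrite Z in Hre.
      replace (c - c) with 0 in Hre by ring.
      symmetry in Hre; apply Rmult_integral in Hre; destruct Hre as [Hre | Hre]; [lra |].
      now apply Rinv_neq_0_compat in Hre; [| lra].
    * apply Rmult_eq_0_compat; right; apply Hcr.
      rewrite Z in Hre; unfold Rdiv in Hre at 2.
      replace (- (c - c)) with 0 in Hre by ring; rewrite Rmult_0_l in Hre; rewrite Z; lra.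
- unfold refine, drefine; apply C11_glue; auto.
  + lra.
  + rewrite glue_left by lra; auto.
  + rewrite glue_left by lra; auto.
  + intros x y Hx Hy; apply H0; lra.
  + apply C11_glue; auto.
    * lra.
    * apply C11_pull; [lra | exact (ext_C11 _ _ _ _ _ _ _ _ E)].
    * intros x y Hx Hy; apply H0; lra.
Qed.

(** * The limit of the refinements *)

Definition approx (a b : R) (f0 : R -> R) (n : nat) : R -> R :=
  Nat.iter n (refine a b f0) f0.

Definition dapprox (a b : R) (d0 : R -> R) (n : nat) : R -> R :=
  Nat.iter n (drefine a b d0) d0.

(** Each rescaling multiplies the distance to c by 1/(b-a), so a point at
    distance more than (b-a)^n leaves J after fewer than n rescalings, and from
    then on its image is read off the seed. *)
Lemma approx_stable a b c f0 d0 n m x :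
  a < b -> b - (b - a) * c = c -> 0 <= c <= 1 -> 0 <= x <= 1 ->
  (b - a) ^ n < Rabs (x - c) -> (n <= m)%nat ->
  approx a b f0 m x = approx a b f0 n x /\ dapprox a b d0 m x = dapprox a b d0 n x.
Proof.
intros Hab Hc c01; revert m x.
induction n as [| n IH]; intros m x Hx Hd Hm.
{ exfalso; simpl in Hd; revert Hd; apply Rle_not_lt, Rabs_le; lra. }
destruct m as [| m]; [lia |].
change (refine a b f0 (approx a b f0 m) x = refine a b f0 (approx a b f0 n) x /\
  drefine a b d0 (dapprox a b d0 m) x = drefine a b d0 (dapprox a b d0 n) x).
unfold refine, drefine, glue.
destruct (Rle_dec x a) as [? | xa]; [auto |].
destruct (Rle_dec x b) as [xb | ?]; [| auto].
unfold pull, dpull.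
destruct (IH m ((b - x) / (b - a))) as [I1 I2].
- apply rescale_unit; lra.
- rewrite (rescale_center a b c x Hab Hc).
  unfold Rdiv; rewrite Rabs_mult, Rabs_inv, Rabs_Ropp, (Rabs_pos_eq (b - a)) by lra.
  apply Rmult_lt_reg_r with (b - a); [lra |].
  rewrite Rmult_assoc, Rinv_l by lra.
  simpl in Hd; lra.
- lia.
- rewrite I1, I2; auto.
Qed.

Lemma extends_seed_approx K a b e c f0 d0 n :
  0 <= K -> seed a b e c f0 d0 -> C11 K f0 d0 0 1 ->
  extends_seed K a b c f0 d0 (approx a b f0 n) (dapprox a b d0 n).
Proof.
intros HK S H0; induction n as [| n IH].
- split; simpl; auto; apply S.
- apply extends_seed_refine with e; auto.
Qed.

Definition eventually_equal (u : nat -> R -> R) (f : R -> R) (x : R) : Prop :=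
  exists N, forall n, (N <= n)%nat -> u n x = f x.

(** A sequence of functions that stabilizes at each point of P, at a time that
    may depend on the point, has a limit; choice picks the stable values. *)
Lemma eventual_limit (u : nat -> R -> R) (P : R -> Prop) :
  (forall x, P x -> exists N, forall n, (N <= n)%nat -> u n x = u N x) ->
  exists f, forall x, P x -> eventually_equal u f x.
Proof.
intros H.
assert (H' : forall x, exists v, P x -> exists N, forall n, (N <= n)%nat -> u n x = v).
{ intros x; destruct (classic (P x)) as [Hx | Hx].
  - destruct (H x Hx) as [N HN]; exists (u N x); eauto.
  - exists 0; tauto. }
exists (fun x => proj1_sig (constructive_indefinite_description _ (H' x))).
intros x; exact (proj2_sig (constructive_indefinite_description _ (H' x))).
Qed.

Lemma refinement_limit a b e c f0 d0 : seed a b e c f0 d0 ->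
  exists K f d, extends_seed K a b c f0 d0 f d /\
    forall x, a <= x <= b -> f x = pull a b f x.
Proof.
intros S.
destruct (seed_order _ _ _ _ _ _ S) as [He [Hab Hb1]].
assert (Hl2 : 0 < (b - a) ^ 2) by (apply pow_lt; lra).
pose proof (seed_center _ _ _ _ _ _ S) as Hc.
destruct (center_bounds a b c) as [c01 cab]; [lra | lra | exact Hc |].
destruct (seed_C11 _ _ _ _ _ _ S) as [K0 HK0].
set (K := Rabs K0).
assert (HK : 0 <= K) by apply Rabs_pos.
assert (H0 : C11 K f0 d0 0 1) by (revert HK0; apply C11_weaken, Rle_abs).
assert (HE := fun n => extends_seed_approx K a b e c f0 d0 n HK S H0).
assert (Hst : forall x, 0 <= x <= 1 -> exists N, forall n, (N <= n)%nat ->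
  approx a b f0 n x = approx a b f0 N x /\ dapprox a b d0 n x = dapprox a b d0 N x).
{ intros x Hx; destruct (Req_dec x c) as [-> | Hxc].
  - exists O; intros n _; split.
    + now rewrite !(ext_peak _ _ _ _ _ _ _ _ (HE _)).
    + transitivity 0; [| symmetry]; apply (ext_critical _ _ _ _ _ _ _ _ (HE _)); auto.
  - destruct (pow_lt_1_zero (b - a)) with (y := Rabs (x - c)) as [N HN].
    + rewrite Rabs_pos_eq; lra.
    + apply Rabs_pos_lt; lra.
    + exists N; intros n Hn; apply approx_stable with c; auto; [lra |].
      rewrite <- (Rabs_pos_eq ((b - a) ^ N)) by (apply pow_le; lra).
      apply HN; lia. }
destruct (eventual_limit (approx a b f0) (fun x => 0 <= x <= 1)) as [f Hf].
{ intros x Hx; destruct (Hst x Hx) as [N HN]; exists N; apply HN. }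
destruct (eventual_limit (dapprox a b d0) (fun x => 0 <= x <= 1)) as [d Hd].
{ intros x Hx; destruct (Hst x Hx) as [N HN]; exists N; apply HN. }
exists K, f, d.
assert (E : extends_seed K a b c f0 d0 f d).
{ split.
  - intros x Hx Ho; destruct (Hf x Hx) as [N HN], (Hd x Hx) as [M HM].
    rewrite <- (HN (N + M)%nat), <- (HM (N + M)%nat) by lia.
    now apply (ext_outside _ _ _ _ _ _ _ _ (HE _)).
  - intros x Hx; destruct (Hf x Hx) as [N HN].
    rewrite <- (HN N) by lia; now apply (ext_range _ _ _ _ _ _ _ _ (HE _)).
  - destruct (Hf c) as [N HN]; [lra |].
    rewrite <- (HN N) by lia; apply (ext_peak _ _ _ _ _ _ _ _ (HE _)).
  - intros x Hx; destruct (Hd x Hx) as [N HN].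
    rewrite <- (HN N) by lia; now apply (ext_critical _ _ _ _ _ _ _ _ (HE _)).
  - intros x y Hx Hy.
    destruct (Hf x Hx) as [N1 H1], (Hd x Hx) as [N2 H2], (Hf y Hy) as [N3 H3],
      (Hd y Hy) as [N4 H4].
    set (n := (N1 + N2 + N3 + N4)%nat).
    rewrite <- (H1 n), <- (H2 n), <- (H3 n), <- (H4 n) by lia.
    now apply (ext_C11 _ _ _ _ _ _ _ _ (HE _)). }
split; [exact E |].
intros x Hx; destruct (Req_dec x a) as [-> | Hxa].
- destruct (extends_seed_at_ends _ _ _ _ _ _ _ _ _ S E) as [[Ea _] _].
  rewrite <- Ea; apply (ext_outside _ _ _ _ _ _ _ _ E); lra.
- assert (Hy : 0 <= (b - x) / (b - a) <= 1) by (apply rescale_unit; lra).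
  destruct (Hf x) as [N HN]; [lra |].
  destruct (Hf _ Hy) as [M HM].
  rewrite <- (HN (Datatypes.S (N + M))) by lia.
  change (refine a b f0 (approx a b f0 (N + M)) x = pull a b f x).
  rewrite refine_inside by lra.
  unfold pull; f_equal; f_equal; f_equal; apply HM; lia.
Qed.

(** * Self-similar maps are fixed points *)

(** Writing f y = 1 - (b-a)^2 * (1 - f z) for y = h z in J, the two affine
    branches undo the quadratic scaling: f^3 y = h (f z), which is Rf = f.  The
    combinatorics of J, f(J), f^2(J) needs only 0 <= f z <= 1. *)
Lemma self_similar_fixed_point K a b e c f0 d0 f d :
  seed a b e c f0 d0 -> extends_seed K a b c f0 d0 f d ->
  (forall x, a <= x <= b -> f x = pull a b f x) -> C1Lip_fixed_point f.
Proof.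
intros S E Hself.
destruct (seed_order _ _ _ _ _ _ S) as [He [Hab Hb1]].
assert (Hl2 : 0 < (b - a) ^ 2) by (apply pow_lt; lra).
pose proof (seed_center _ _ _ _ _ _ S) as Hc.
destruct (center_bounds a b c) as [c01 cab]; [lra | lra | exact Hc |].
assert (HJ2 : forall x, 0 <= x <= e -> f x = a + (b - a) / e * x).
{ intros x Hx; rewrite <- (seed_J2 _ _ _ _ _ _ S x Hx).
  apply (ext_outside _ _ _ _ _ _ _ _ E); lra. }
assert (HJ1 : forall x, 1 - (b - a) ^ 2 <= x <= 1 -> f x = e / (b - a) ^ 2 * (1 - x)).
{ intros x Hx; rewrite <- (seed_J1 _ _ _ _ _ _ S x Hx).
  apply (ext_outside _ _ _ _ _ _ _ _ E); lra. }
assert (f0_eq : f 0 = a) by (rewrite HJ2 by lra; ring).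
assert (f1_eq : f 1 = 0) by (rewrite HJ1 by lra; ring).
(* The images of y in J are affine in the value of f at the rescaled point z. *)
assert (Horb : forall y, a <= y <= b ->
  let z := (b - y) / (b - a) in
  0 <= f z <= 1 /\ f y = 1 - (b - a) ^ 2 * (1 - f z) /\
  f (f y) = e * (1 - f z) /\ f (f (f y)) = a + (b - a) * (1 - f z)).
{ intros y Hy z.
  assert (Hz : 0 <= f z <= 1) by (apply (ext_range _ _ _ _ _ _ _ _ E), rescale_unit; lra).
  assert (Ey : f y = 1 - (b - a) ^ 2 * (1 - f z)) by (rewrite Hself by lra; reflexivity).
  assert (Ey2 : f (f y) = e * (1 - f z)).
  { rewrite HJ1; rewrite Ey; [field; lra | nra]. }
  repeat split; try lra.
  rewrite HJ2; rewrite Ey2; [field; lra | nra]. }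
assert (f4_eq : Nat.iter 4 f 0 = b).
{ simpl; rewrite f0_eq.
  destruct (Horb a) as (_ & _ & _ & ->); [lra |].
  replace ((b - a) / (b - a)) with 1 by (field; lra); rewrite f1_eq; ring. }
exists c; split; [| split].
- exists d; split; [| exact (C11_lipschitz _ _ _ (ext_C11 _ _ _ _ _ _ _ _ E))].
  split; [exact (ext_range _ _ _ _ _ _ _ _ E) |].
  split; [exact (C11_derivative _ _ _ (ext_C11 _ _ _ _ _ _ _ _ E)) |].
  split; [exact (lipschitz_continuous _
    (C11_lipschitz _ _ _ (ext_C11 _ _ _ _ _ _ _ _ E))) |].
  split; [| split; [exact (ext_peak _ _ _ _ _ _ _ _ E) | exact f1_eq]].
  split.
  + split; [unfold unit_interval; lra |].
    apply (ext_critical _ _ _ _ _ _ _ _ E); lra.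
  + intros x [Hx Zx]; symmetry; now apply (ext_critical _ _ _ _ _ _ _ _ E).
- unfold tripling_renormalizable; cbv zeta.
  assert (HJ : forall y, J f y <-> a <= y <= b).
  { intros y; unfold J; rewrite f0_eq, f4_eq; tauto. }
  assert (I1 : forall v, image_dir f (J f) v -> 1 - (b - a) ^ 2 <= v).
  { intros v [y [-> Hy]]; apply HJ in Hy.
    destruct (Horb y Hy) as (? & -> & _); nra. }
  assert (I2 : forall v, image_dir (Nat.iter 2 f) (J f) v -> v <= e).
  { intros v [y [-> Hy]]; apply HJ in Hy; simpl.
    destruct (Horb y Hy) as (? & _ & -> & _); nra. }
  split; [rewrite f0_eq, f4_eq; exact cab |].
  split.
  { split.
    - intros y Hy; apply HJ in Hy; unfold unit_interval; lra.
    - intros N; assert (H0 : J f 0) by (apply N; unfold unit_interval; lra).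
      apply HJ in H0; lra. }
  split; [intros v [V1 V2]; apply interior_P1 in V1, V2;
    apply I2 in V1; apply HJ in V2; lra |].
  split; [intros v [V1 V2]; apply interior_P1 in V1, V2;
    apply HJ in V1; apply I1 in V2; lra |].
  split; [intros v [V1 V2]; apply interior_P1 in V1, V2;
    apply I2 in V1; apply I1 in V2; lra |].
  split; [intros u v U V; apply I2 in U; apply HJ in V; lra |].
  split; [intros u v U V; apply HJ in U; apply I1 in V; lra |].
  intros v [y [-> Hy]]; apply HJ in Hy; apply HJ; simpl.
  destruct (Horb y Hy) as (? & _ & _ & ->); nra.
- intros x Hx; unfold unit_interval in Hx.
  unfold renormalization, h, h_inv; rewrite f0_eq, f4_eq; simpl.
  destruct (Horb (b - (b - a) * x)) as (_ & _ & _ & ->); [nra |].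
  replace ((b - (b - (b - a) * x)) / (b - a)) with x by (field; lra).
  field; lra.
Qed.

Theorem seed_fixed_point a b e c f0 d0 : seed a b e c f0 d0 ->
  exists f, C1Lip_fixed_point f /\
    forall x, 0 <= x <= 1 -> x <= a \/ b <= x -> f x = f0 x.
Proof.
intros S; destruct (refinement_limit _ _ _ _ _ _ S) as (K & f & d & E & Hself).
exists f; split; [exact (self_similar_fixed_point _ _ _ _ _ _ _ _ _ S E Hself) |].
intros x Hx Ho; apply (ext_outside _ _ _ _ _ _ _ _ E x Hx Ho).
Qed.

(** * Quartic arcs with prescribed end values and end slopes *)

(** Bernstein form is used because the range, the end values, the end slopes and
    the sign of the derivative can all be read off the control values, while b2
    enters neither the values nor the slopes at the ends. *)
Definition bernstein4 (b0 b1 b2 b3 b4 s : R) : R :=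
  b0 * (1 - s) ^ 4 + 4 * b1 * s * (1 - s) ^ 3 + 6 * b2 * s ^ 2 * (1 - s) ^ 2
  + 4 * b3 * s ^ 3 * (1 - s) + b4 * s ^ 4.

Definition dbernstein4 (b0 b1 b2 b3 b4 s : R) : R :=
  4 * ((b1 - b0) * (1 - s) ^ 3 + 3 * (b2 - b1) * s * (1 - s) ^ 2
       + 3 * (b3 - b2) * s ^ 2 * (1 - s) + (b4 - b3) * s ^ 3).

(** The Taylor remainder of a polynomial is (y - x)^2 times a polynomial in x
    and y, which is bounded on the unit square. *)
Lemma bernstein4_C11 b0 b1 b2 b3 b4 :
  exists K, C11 K (bernstein4 b0 b1 b2 b3 b4) (dbernstein4 b0 b1 b2 b3 b4) 0 1.
Proof.
(* Coefficients of s^2, s^3 and s^4 in the monomial basis. *)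
set (a2 := 6 * (b0 - 2 * b1 + b2)).
set (a3 := 4 * (b3 - 3 * b2 + 3 * b1 - b0)).
set (a4 := b0 - 4 * b1 + 6 * b2 - 4 * b3 + b4).
exists (2 * Rabs a2 + 6 * Rabs a3 + 12 * Rabs a4).
assert (bound : forall r s t A B C, 0 <= r <= A -> 0 <= s <= B -> 0 <= t <= C ->
  Rabs (a2 * r + a3 * s + a4 * t) <= A * Rabs a2 + B * Rabs a3 + C * Rabs a4).
{ intros r s t A B C Hr Hs Ht.
  eapply Rle_trans; [apply Rabs_triang |].
  eapply Rle_trans; [apply Rplus_le_compat_r, Rabs_triang |].
  rewrite !Rabs_mult, (Rabs_pos_eq r), (Rabs_pos_eq s), (Rabs_pos_eq t) by lra.
  pose proof (Rabs_pos a2); pose proof (Rabs_pos a3); pose proof (Rabs_pos a4); nra. }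
intros x y Hx Hy; split.
- replace (bernstein4 b0 b1 b2 b3 b4 y - bernstein4 b0 b1 b2 b3 b4 x
    - dbernstein4 b0 b1 b2 b3 b4 x * (y - x)) with
    ((a2 * 1 + a3 * (2 * x + y) + a4 * (3 * x ^ 2 + 2 * x * y + y ^ 2)) * (y - x) ^ 2)
    by (unfold bernstein4, dbernstein4, a2, a3, a4; ring).
  rewrite Rabs_mult, (Rabs_pos_eq ((y - x) ^ 2)) by apply pow2_ge_0.
  apply Rmult_le_compat_r; [apply pow2_ge_0 |].
  apply bound; nra.
- replace (dbernstein4 b0 b1 b2 b3 b4 y - dbernstein4 b0 b1 b2 b3 b4 x) with
    ((a2 * 2 + a3 * (3 * (x + y)) + a4 * (4 * (x ^ 2 + x * y + y ^ 2))) * (y - x))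
    by (unfold bernstein4, dbernstein4, a2, a3, a4; ring).
  rewrite Rabs_mult; apply Rmult_le_compat_r; [apply Rabs_pos |].
  apply bound; nra.
Qed.

Lemma bernstein4_nonneg b0 b1 b2 b3 b4 s :
  0 <= b0 -> 0 <= b1 -> 0 <= b2 -> 0 <= b3 -> 0 <= b4 -> 0 <= s <= 1 ->
  0 <= bernstein4 b0 b1 b2 b3 b4 s.
Proof.
intros; unfold bernstein4.
repeat apply Rplus_le_le_0_compat; repeat apply Rmult_le_pos; try apply pow_le; lra.
Qed.

Lemma bernstein4_unit b0 b1 b2 b3 b4 s :
  0 <= b0 <= 1 -> 0 <= b1 <= 1 -> 0 <= b2 <= 1 -> 0 <= b3 <= 1 -> 0 <= b4 <= 1 ->
  0 <= s <= 1 -> 0 <= bernstein4 b0 b1 b2 b3 b4 s <= 1.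
Proof.
intros; split; [apply bernstein4_nonneg; lra |].
enough (0 <= bernstein4 (1 - b0) (1 - b1) (1 - b2) (1 - b3) (1 - b4) s).
{ replace (bernstein4 b0 b1 b2 b3 b4 s) with
    (1 - bernstein4 (1 - b0) (1 - b1) (1 - b2) (1 - b3) (1 - b4) s)
    by (unfold bernstein4; ring); lra. }
apply bernstein4_nonneg; lra.
Qed.

(** The quartic on [p,q] with values u, v and slopes du, dv at the ends; the
    middle control value m is free. *)
Definition arc (p q u v du dv m x : R) : R :=
  bernstein4 u (u + (q - p) * du / 4) m (v - (q - p) * dv / 4) v ((x - p) / (q - p)).

Definition darc (p q u v du dv m x : R) : R :=
  / (q - p) *
  dbernstein4 u (u + (q - p) * du / 4) m (v - (q - p) * dv / 4) v ((x - p) / (q - p)).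

Lemma arc_ends p q u v du dv m : p < q ->
  (arc p q u v du dv m p = u /\ darc p q u v du dv m p = du) /\
  (arc p q u v du dv m q = v /\ darc p q u v du dv m q = dv).
Proof.
intros H; unfold arc, darc.
replace ((p - p) / (q - p)) with 0 by (field; lra).
replace ((q - p) / (q - p)) with 1 by (field; lra).
unfold bernstein4, dbernstein4; repeat split; field; lra.
Qed.

Lemma arc_coordinate p q x : p < q -> p <= x <= q -> 0 <= (x - p) / (q - p) <= 1.
Proof.
intros Hpq Hx; split.
- apply Rmult_le_pos; [lra | left; apply Rinv_0_lt_compat; lra].
- apply Rmult_le_reg_r with (q - p); [lra |].
  unfold Rdiv; rewrite Rmult_assoc, Rinv_l; lra.
Qed.

Lemma arc_C11 p q u v du dv m : p < q ->
  exists K, C11 K (arc p q u v du dv m) (darc p q u v du dv m) p q.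
Proof.
intros Hpq.
destruct (bernstein4_C11 u (u + (q - p) * du / 4) m (v - (q - p) * dv / 4) v) as [K HK].
assert (E : forall x, / (q - p) * x + - p / (q - p) = (x - p) / (q - p))
  by (intros; field; lra).
eexists; eapply C11_ext;
  [| | apply (C11_affine 0 1 (/ (q - p)) (- p / (q - p)) _ _ _ _ _ p q HK)];
  intros x Hx; unfold arc, darc; rewrite E.
- ring.
- ring.
- now apply arc_coordinate.
Qed.

Lemma arc_unit p q u v du dv m x : p < q -> p <= x <= q ->
  0 <= u <= 1 -> 0 <= u + (q - p) * du / 4 <= 1 -> 0 <= m <= 1 ->
  0 <= v - (q - p) * dv / 4 <= 1 -> 0 <= v <= 1 -> 0 <= arc p q u v du dv m x <= 1.
Proof.
intros Hpq Hx; intros; apply bernstein4_unit; auto; now apply arc_coordinate.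
Qed.

(** Nondecreasing control values make the derivative a sum of nonnegative terms;
    the alternative at the end keeps one of the two extreme terms positive. *)
Lemma darc_pos p q u v du dv m x : p < q -> p <= x <= q -> 0 <= du -> 0 <= dv ->
  u + (q - p) * du / 4 <= m <= v - (q - p) * dv / 4 ->
  (0 < du /\ x < q) \/ (0 < dv /\ p < x) -> 0 < darc p q u v du dv m x.
Proof.
intros Hpq Hx Hdu Hdv Hm Hs; unfold darc, dbernstein4.
pose proof (arc_coordinate p q x Hpq Hx) as H01.
assert (Hs0 : p < x -> 0 < (x - p) / (q - p)) by (intros; apply Rdiv_lt_0_compat; lra).
assert (Hs1 : x < q -> 0 < 1 - (x - p) / (q - p)).
{ intros; replace (1 - (x - p) / (q - p)) with ((q - x) / (q - p)) by (field; lra).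
  apply Rdiv_lt_0_compat; lra. }
set (s := (x - p) / (q - p)) in *; clearbody s.
apply Rmult_lt_0_compat; [apply Rinv_0_lt_compat; lra |].
apply Rmult_lt_0_compat; [lra |].
assert (0 <= (q - p) * du) by (apply Rmult_le_pos; lra).
assert (0 <= (q - p) * dv) by (apply Rmult_le_pos; lra).
assert (T0 : 0 <= (u + (q - p) * du / 4 - u) * (1 - s) ^ 3)
  by (apply Rmult_le_pos; [lra | apply pow_le; lra]).
assert (T1 : 0 <= 3 * (m - (u + (q - p) * du / 4)) * s * (1 - s) ^ 2)
  by (repeat apply Rmult_le_pos; try apply pow_le; lra).
assert (T2 : 0 <= 3 * (v - (q - p) * dv / 4 - m) * s ^ 2 * (1 - s))
  by (repeat apply Rmult_le_pos; try apply pow_le; lra).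
assert (T3 : 0 <= (v - (v - (q - p) * dv / 4)) * s ^ 3)
  by (apply Rmult_le_pos; [lra | apply pow_le; lra]).
destruct Hs as [[Hd Hxq] | [Hd Hpx]].
- assert (0 < (u + (q - p) * du / 4 - u) * (1 - s) ^ 3); [| lra].
  assert (0 < (q - p) * du) by (apply Rmult_lt_0_compat; lra).
  apply Rmult_lt_0_compat; [lra | apply pow_lt; auto].
- assert (0 < (v - (v - (q - p) * dv / 4)) * s ^ 3); [| lra].
  assert (0 < (q - p) * dv) by (apply Rmult_lt_0_compat; lra).
  apply Rmult_lt_0_compat; [lra | apply pow_lt; auto].
Qed.

Lemma darc_neg p q u v du dv m x : p < q -> p <= x <= q -> du <= 0 -> dv <= 0 ->
  v - (q - p) * dv / 4 <= m <= u + (q - p) * du / 4 ->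
  (du < 0 /\ x < q) \/ (dv < 0 /\ p < x) -> darc p q u v du dv m x < 0.
Proof.
intros Hpq Hx Hdu Hdv Hm Hs.
enough (0 < darc p q (- u) (- v) (- du) (- dv) (- m) x).
{ replace (darc p q u v du dv m x) with (- darc p q (- u) (- v) (- du) (- dv) (- m) x)
    by (unfold darc, dbernstein4; field; lra); lra. }
apply darc_pos; lra.
Qed.

(** * A one-parameter family of seeds *)

(** Here J = [2/5, 3/5], so l = 1/5, c = 1/2, f^2(J) = [0, 1/10] and
    f(J) = [24/25, 1].  With f(0) = 2/5, f(1) = 0 and end slopes 2 and -5/2,
    the matching conditions impose the value 24/25 = 1 - l^2 and slope
    1/2 = -l * (-5/2) at 2/5, and the value 122/125 = 1 - l^2 * (3/5) and slope
    -2/5 = -l * 2 at 3/5.  The middle control values 99/100, 99/100 and 1/2 are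
    arbitrary between their neighbours; m is the parameter of the family. *)
Definition seed_map (m : R) : R -> R :=
  glue (1/10) (fun x => 2/5 + 2 * x)
  (glue (2/5) (arc (1/10) (2/5) (3/5) (24/25) 2 (1/2) m)
  (glue (1/2) (arc (2/5) (1/2) (24/25) 1 (1/2) 0 (99/100))
  (glue (3/5) (arc (1/2) (3/5) 1 (122/125) 0 (- (2/5)) (99/100))
  (glue (24/25) (arc (3/5) (24/25) (122/125) (1/10) (- (2/5)) (- (5/2)) (1/2))
  (fun x => 5/2 + - (5/2) * x))))).

Definition dseed_map (m : R) : R -> R :=
  glue (1/10) (fun _ => 2)
  (glue (2/5) (darc (1/10) (2/5) (3/5) (24/25) 2 (1/2) m)
  (glue (1/2) (darc (2/5) (1/2) (24/25) 1 (1/2) 0 (99/100))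
  (glue (3/5) (darc (1/2) (3/5) 1 (122/125) 0 (- (2/5)) (99/100))
  (glue (24/25) (darc (3/5) (24/25) (122/125) (1/10) (- (2/5)) (- (5/2)) (1/2))
  (fun _ => - (5/2)))))).

Lemma affine_C11 u v p q : exists K, C11 K (fun x => u + v * x) (fun _ => v) p q.
Proof.
exists 0; intros x y _ _; split.
- replace (u + v * y - (u + v * x) - v * (y - x)) with 0 by ring; rewrite Rabs_R0; lra.
- replace (v - v) with 0 by ring; rewrite Rabs_R0; lra.
Qed.

Ltac unglue := repeat first [rewrite glue_left by lra | rewrite glue_right by lra].

Ltac arc_end p q u v du dv m :=
  let H := fresh in
  pose proof (arc_ends p q u v du dv m ltac:(lra)) as H;
  destruct H as [[? ?] [? ?]].

Lemma seed_map_C11 m : exists K, C11 K (seed_map m) (dseed_map m) 0 1.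
Proof.
arc_end (1/10) (2/5) (3/5) (24/25) 2 (1/2) m.
arc_end (2/5) (1/2) (24/25) 1 (1/2) 0 (99/100).
arc_end (1/2) (3/5) 1 (122/125) 0 (- (2/5)) (99/100).
arc_end (3/5) (24/25) (122/125) (1/10) (- (2/5)) (- (5/2)) (1/2).
unfold seed_map, dseed_map.
apply C11_glue_exists; [lra | unglue; lra | unglue; lra | apply affine_C11 |].
do 4 (apply C11_glue_exists; [lra | unglue; lra | unglue; lra | apply arc_C11; lra |]).
apply (affine_C11 (5/2) (- (5/2)) (24/25) 1).
Qed.

Lemma seed_map_unit m x : 0 <= m <= 1 -> 0 <= x <= 1 -> 0 <= seed_map m x <= 1.
Proof.
intros Hm Hx; unfold seed_map, glue.
repeat destruct Rle_dec; try (apply arc_unit; lra); lra.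
Qed.

(** The bounds on m are the neighbouring control values of the arc on
    [1/10, 2/5]: 3/5 + (3/10) * 2 / 4 and 24/25 - (3/10) * (1/2) / 4. *)
Lemma dseed_map_critical m x : 3/4 <= m <= 369/400 -> 0 <= x <= 1 ->
  dseed_map m x = 0 <-> x = 1/2.
Proof.
intros Hm Hx; split.
- intros Z; destruct (Rtotal_order x (1/2)) as [N | [? | N]]; auto; exfalso.
  + enough (0 < dseed_map m x) by lra.
    unfold dseed_map, glue; repeat destruct Rle_dec; try lra; apply darc_pos; lra.
  + enough (dseed_map m x < 0) by lra.
    unfold dseed_map, glue; repeat destruct Rle_dec; try lra; apply darc_neg; lra.
- intros ->; unfold dseed_map; unglue; apply arc_ends; lra.
Qed.

Lemma seed_map_seed m : 3/4 <= m <= 369/400 ->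
  seed (2/5) (3/5) (1/10) (1/2) (seed_map m) (dseed_map m).
Proof.
intros Hm.
arc_end (1/10) (2/5) (3/5) (24/25) 2 (1/2) m.
arc_end (2/5) (1/2) (24/25) 1 (1/2) 0 (99/100).
arc_end (1/2) (3/5) 1 (122/125) 0 (- (2/5)) (99/100).
arc_end (3/5) (24/25) (122/125) (1/10) (- (2/5)) (- (5/2)) (1/2).
assert (Hab : 2/5 < 3/5) by lra.
split.
- lra.
- lra.
- intros x Hx; unfold seed_map; unglue; lra.
- intros x Hx; unfold seed_map.
  replace (1 / 10 / (3 / 5 - 2 / 5) ^ 2) with (5/2) by lra.
  destruct (Req_dec x (24/25)) as [-> | Hne]; unglue; lra.
- rewrite (proj1 (pull_ends _ _ _ Hab)), (proj1 (dpull_ends _ _ _ Hab)).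
  unfold seed_map, dseed_map; unglue; lra.
- rewrite (proj2 (pull_ends _ _ _ Hab)), (proj2 (dpull_ends _ _ _ Hab)).
  unfold seed_map, dseed_map; unglue; lra.
- intros x Hx; apply seed_map_unit; lra.
- unfold seed_map; unglue; assumption.
- intros x Hx; now apply dseed_map_critical.
- apply seed_map_C11.
Qed.

(** The midpoint of the arc carrying the parameter m tells the seeds apart. *)
Lemma seed_map_quarter m : seed_map m (1/4) = 33/64 + 3/8 * m.
Proof.
unfold seed_map; unglue; unfold arc, bernstein4.
field.
Qed.

(** An injection of the line into the allowed control values: |atan| < 2. *)
Lemma control_value_range t : 3/4 <= 21/25 + atan t / 50 <= 369/400.
Proof. pose proof (atan_bound t); pose proof PI_4; lra. Qed.

Theorem theorem2p10 : continuum_of C1Lip_fixed_point.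
Proof.
pose (F t := constructive_indefinite_description _
  (seed_fixed_point _ _ _ _ _ _ (seed_map_seed _ (control_value_range t)))).
exists (fun t => proj1_sig (F t)); split.
- intros t; apply (proj2_sig (F t)).
- intros s t Hst E.
  pose proof (E (1/4) ltac:(unfold unit_interval; lra)) as E4; cbv beta in E4.
  rewrite (proj2 (proj2_sig (F s))) in E4 by lra.
  rewrite (proj2 (proj2_sig (F t))) in E4 by lra.
  rewrite !seed_map_quarter in E4.
  destruct (Rtotal_order s t) as [N | [N | N]]; [| contradiction |];
    apply atan_increasing in N; lra.
Qed.
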